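(* Let $\mathcal G=(\mathcal V,\mathcal E)$ be a bipartite graph and let $X$ be an n.n.constraint space on $\mathcal G$ which is Hammersley-Clifford. Then every strong config-fold of $X$ is Hammersley-Clifford, and every strong config-unfold of $X$ is Hammersley-Clifford.
   Context: Graphs: a graph $\mathcal G=(\mathcal V,\mathcal E)$ is a countable, locally finite, undirected graph without self-loops or multiple edges; $\sim$ denotes adjacency, $d_{\mathcal G}$ graph distance. For $F\subset\mathcal V$, $\partial F=\{u\in\mathcal V\setminus F: u\sim v\text{ for some }v\in F\}$, and $D_n(v)=\{w: d_{\mathcal G}(v,w)\le n\}$. A clique is a finite set of pairwise adjacent vertices (single vertices included). Configurations: $\mathcal A$ is a finite alphabet, $\mathcal A^{\mathcal V}$ has the product topology, patterns are elements of $\mathcal A^F$, $F\subset \mathcal V$. For closed $X\subset\mathcal A^{\mathcal V}$, $\mathcal L_F(X)=\{x|_F:x\in X\}$ and $\mathcal L(X)=\bigcup_{F\text{ finite}}\mathcal L_F(X)$. $\langle a,c\rangle_{\{v,w\}}$ is the pattern with value $a$ at $v$ and $c$ at $w$; $b^F$ is the pattern on $F$ constantly $b$. An n.n.constraint space is a set of the form $\{x\in\mathcal A^{\mathcal V}:\text{ no pattern from }\mathcal F\text{ appears in }x\}$ where $\mathcal F$ is a set of patterns on cliques. Cocycles: $\Delta_X=\{(x,y)\in X\times X: x,y\text{ differ at finitely many sites}\}$. A $\Delta_X$-cocycle is $M:\Delta_X\to\mathbb R$ with $M(x,z)=M(x,y)+M(y,z)$ for $(x,y),(y,z)\in\Delta_X$.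 It is a Markov cocycle if $M(x,y)$ depends only on $x|_{F\cup\partial F}$ and $y|_{F\cup\partial F}$, where $F$ is the set of sites where $x$ and $y$ differ. A nearest neighbour interaction on $X$ is $V:\mathcal L(X)\to\mathbb R$ vanishing on patterns on finite sets that are not cliques. The Gibbs cocycle with interaction $V$ is $M(x,y)=\sum_{A\subset\mathcal V\text{ finite}}\big(V(y|_A)-V(x|_A)\big)$. $\mathbf M_X$ is the space of Markov cocycles on $X$, $\mathbf G_X$ the space of Gibbs cocycles on $X$ with nearest neighbour interactions. $X$ is Hammersley-Clifford if $\mathbf M_X=\mathbf G_X$. Folding: let $\mathcal G$ be bipartite, $X\subset\mathcal A^{\mathcal V}$ an n.n.constraint space, and $a,b\in\mathcal A$ distinct. $a$ can be strongly config-folded into $b$ if for all edges $(v_1,v_2),(v_2,v_3)\in\mathcal E$ and all $c\in\mathcal A$, $\langle a,c\rangle_{\{v_1,v_2\}}\in\mathcal L_{\{v_1,v_2\}}(X)$ implies $\langle b,c\rangle_{\{v_1,v_2\}}\in\mathcal L_{\{v_1,v_2\}}(X)$, $\langle c,b\rangle_{\{v_2,v_3\}}\in\mathcal L_{\{v_2,v_3\}}(X)$ and $b^{\partial D_1(v_1)}\in\mathcal L_{\partial D_1(v_1)}(X)$. In that case $X_a:=X\cap(\mathcal A\setminus\{a\})^{\mathcal V}$ is called a strong config-fold of $X$, and $X$ is called a strong config-unfold of $X_a$.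
   Formalization: For strong config-unfolds, X is additionally assumed to be nonempty; without this the claim fails on graphs with isolated vertices, where a nonempty space that is not Hammersley-Clifford can be a strong config-unfold of the empty space. *)

(* Defs.v *)
From mathcomp Require Import all_boot all_order all_algebra finmap.
From mathcomp Require Import mathcomp_extra boolp classical_sets functions.
From mathcomp Require Import cardinality fsbigop reals.

Set Implicit Arguments.
Unset Strict Implicit.
Unset Printing Implicit Defensive.

Import GRing.Theory.
Local Open Scope classical_set_scope.
Local Open Scope ring_scope.

Record graph := Graph {
  vertex :> countType;
  adj : rel vertex;
  adj_sym : symmetric adj;
  adj_irrefl : irreflexive adj;
  adj_locally_finite : forall v, finite_set [set w | adj v w]
}.

Definition bipartite (G : graph) : Prop :=
  exists side : G -> bool, forall u v : G, adj u v -> side u != side v.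

Definition boundary (G : graph) (F : set G) : set G :=
  [set u | ~ F u /\ exists2 v, F v & adj u v].

(* Vertices reached from [v] by a walk of at most [n] steps, i.e. at graph
   distance at most [n]; other components are at infinite distance. *)
Definition gball (G : graph) (n : nat) (v : G) : set G :=
  [set w | exists p : seq G,
     [/\ path (@adj G) v p, last v p = w & (size p <= n)%N]].

Definition clique (G : graph) (K : {fset G}) : Prop :=
  forall u v : G, u \in K -> v \in K -> u != v -> adj u v.

Definition config (G : graph) (A : finType) : Type := G -> A.

(* A pattern on a finite set is a finite map; [domf p] is its support. *)
Definition pattern (G : graph) (A : finType) : Type := {fmap G -> A}.

Definition restrict (G : graph) (A : finType) (x : config G A)
    (F : {fset G}) : pattern G A :=
  [fmap v : F => x (val v)].

Definition appears (G : graph) (A : finType) (p : pattern G A)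
    (x : config G A) : Prop :=
  restrict x (domf p) = p.

Definition const_pattern (G : graph) (A : finType) (F : {fset G}) (b : A) :
    pattern G A :=
  [fmap v : F => b].

(* Value [a] at [v] and [c] at [w]; meaningful for [v != w]. *)
Definition pair_pattern (G : graph) (A : finType) (v w : G) (a c : A) :
    pattern G A :=
  [fmap u : [fset v; w]%fset => if val u == v then a else c].

Definition language_on (G : graph) (A : finType) (F : {fset G})
    (X : set (config G A)) : set (pattern G A) :=
  [set restrict x F | x in X].

Definition language (G : graph) (A : finType) (X : set (config G A)) :
    set (pattern G A) :=
  \bigcup_(F in [set: {fset G}]) language_on F X.

Definition nn_constraint_space (G : graph) (A : finType)
    (X : set (config G A)) : Prop :=
  exists2 P : set (pattern G A),
    (forall p, P p -> clique (domf p)) &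
    X = [set x | forall p, P p -> ~ appears p x].

Definition diff_sites (G : graph) (A : finType) (x y : config G A) : set G :=
  [set v | x v <> y v].

Definition Delta (G : graph) (A : finType) (X : set (config G A))
    (x y : config G A) : Prop :=
  [/\ X x, X y & finite_set (diff_sites x y)].

(* A function on [Delta X] is represented by a total function of two
   configurations, and a function on [language X] by a total function on
   patterns. All conditions below only involve values on [Delta X], resp. on
   [language X]: the sets of cocycles are saturated for equality on
   [Delta X]. *)
Definition cocycle (R : realType) (G : graph) (A : finType)
    (X : set (config G A)) (M : config G A -> config G A -> R) : Prop :=
  forall x y z, Delta X x y -> Delta X y z -> M x z = M x y + M y z.

Definition markov_cocycles (R : realType) (G : graph) (A : finType)
    (X : set (config G A)) : set (config G A -> config G A -> R) :=
  [set M | cocycle X M /\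
    forall x y x' y', Delta X x y -> Delta X x' y' ->
      let F := diff_sites x y in
      diff_sites x' y' = F ->
      (forall v, (F `|` boundary F) v -> x' v = x v /\ y' v = y v) ->
      M x' y' = M x y].

Definition nn_interaction (R : realType) (G : graph) (A : finType)
    (X : set (config G A)) (V : pattern G A -> R) : Prop :=
  forall p, language X p -> ~ clique (domf p) -> V p = 0.

(* The sum has finite support: a nonzero term comes from a clique meeting the
   finite set [diff_sites x y], and the graph is locally finite. *)
Definition gibbs_cocycles (R : realType) (G : graph) (A : finType)
    (X : set (config G A)) : set (config G A -> config G A -> R) :=
  [set M | exists2 V : pattern G A -> R, nn_interaction X V &
    forall x y, Delta X x y ->
      M x y = \sum_(F \in [set: {fset G}]) (V (restrict y F) - V (restrict x F))].

Definition hammersley_clifford (R : realType) (G : graph) (A : finType)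
    (X : set (config G A)) : Prop :=
  markov_cocycles X = gibbs_cocycles X :> set (config G A -> config G A -> R).

(* [fset_set] turns the set [boundary (gball 1 v1)], finite by local
   finiteness, into an [{fset G}]. The vertices [v1] and [v3] may coincide. *)
Definition strongly_foldable (G : graph) (A : finType) (X : set (config G A))
    (a b : A) : Prop :=
  forall (v1 v2 v3 : G) (c : A), adj v1 v2 -> adj v2 v3 ->
    language_on [fset v1; v2]%fset X (pair_pattern v1 v2 a c) ->
    let B := fset_set (boundary (gball 1 v1)) in
    [/\ language_on [fset v1; v2]%fset X (pair_pattern v1 v2 b c),
        language_on [fset v2; v3]%fset X (pair_pattern v2 v3 c b) &
        language_on B X (const_pattern B b)].

Definition remove_symbol (G : graph) (A : finType) (X : set (config G A))
    (a : A) : set (config G A) :=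
  X `&` [set x | forall v, x v <> a].

Definition strong_config_fold (G : graph) (A : finType)
    (X Y : set (config G A)) : Prop :=
  nn_constraint_space X /\
  exists a b : A, [/\ a != b, strongly_foldable X a b & Y = remove_symbol X a].

Definition strong_config_unfold (G : graph) (A : finType)
    (X Y : set (config G A)) : Prop :=
  strong_config_fold Y X.

(* Main.v *)
Require Import Defs.
From mathcomp Require Import all_boot all_order all_algebra finmap.
From mathcomp Require Import mathcomp_extra boolp classical_sets functions.
From mathcomp Require Import cardinality fsbigop reals lra.
Local Open Scope classical_set_scope.

Set Implicit Arguments.
Unset Strict Implicit.
Unset Printing Implicit Defensive.

Import GRing.Theory Defs.

(** Let [W] be the space [X] without the symbol [a]. Folding replaces [a] by [b];
    at an isolated vertex, where the folding hypothesis is silent, [a] is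
    replaced by the value there of a fixed member of [W]. So the replacement
    symbol is a configuration [beta], and folding any set of sites maps [X] into
    itself, while folding all of them retracts [X] onto [W]. Everything below
    uses the folding hypothesis only through [site_fold].

    Folds. If [M] is a Markov cocycle on [W] and [f] is the total fold, then
    [M (f x) (f y)] is a Markov cocycle on [X], hence Gibbs, and an interaction
    for it restricts to an interaction for [M] since [f] fixes [W].

    Unfolds. Let [M] be a Markov cocycle on [X]. On [W] it is Gibbs; extending
    an interaction by zero and subtracting the resulting Gibbs cocycle, one may
    assume that [M] vanishes on [W]. Any two configurations that differ finitely
    are joined by finitely many one-site folds, a pair that behaves like a pair
    of [W], and one-site unfolds ([markov_fold_zero]). So it is enough to find an
    interaction that vanishes on patterns without [a] and has the right value
    on each one-site fold.

    The cost of folding [v] depends only on the neighbours of [v]. The point is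
    that it is a constant plus a sum of one term per neighbour ([fold_costE]).
    The third clause of strong foldability allows the surroundings of [v] to be
    replaced by a frame, constantly [b] at distance two. Inside it the
    neighbours of [v] can be changed independently, and as the graph is
    bipartite, changing a neighbour [u] has a cost that ignores the
    other neighbours. Comparing this cost before and after the fold at [v]
    (the square in [fold_cost_increment]) shows that the contributions of
    the neighbours add up. These terms are the sought interaction. Two adjacent
    symbols [a] can be folded in either order, and [nbr_cost_sym] says that both
    orders prescribe the same energy for that edge. *)

(** * Configurations and cocycles *)

Section Configurations.
Local Open Scope ring_scope.
Variables (G : graph) (A : finType).
Implicit Types (x y z : config G A) (v u : G) (F E : {fset G}).

Lemma restrict_fnd x F v :
  (restrict x F).[? v]%fmap = if v \in F then Some (x v) else None.
Proof.
case: (boolP (v \in F)) => vF; last by rewrite not_fnd.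
by rewrite (in_fnd (f := restrict x F) vF) ffunE.
Qed.

Lemma restrictP x y F :
  restrict x F = restrict y F <-> (forall v, v \in F -> x v = y v).
Proof.
split=> [exy v vF|exy].
  have := restrict_fnd x F v; rewrite exy restrict_fnd vF; by case.
by apply/fmapP=> v; rewrite !restrict_fnd; case: ifP => // /exy ->.
Qed.

Lemma finite_boundary (D : set G) : finite_set D -> finite_set (boundary D).
Proof.
move=> fD; apply: (@sub_finite_set _ _ (\bigcup_(v in D) [set w | adj v w])).
  by move=> u [_ [v Dv uv]]; exists v => //=; rewrite adj_sym.
by apply: bigcup_finite => // v _; exact: adj_locally_finite.
Qed.

Lemma Delta_sym (X : set (config G A)) x y : Delta X x y -> Delta X y x.
Proof.
case=> Xx Xy fxy; split=> //; rewrite (_ : diff_sites y x = diff_sites x y) //.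
by apply/seteqP; split=> v /= /nesym.
Qed.

Lemma Delta_refl (X : set (config G A)) x : X x -> Delta X x x.
Proof.
move=> Xx; split=> //; rewrite (_ : diff_sites x x = set0) //.
by apply/seteqP; split=> v.
Qed.

Lemma Delta_agree_off (X : set (config G A)) (D : set G) x y :
  finite_set D -> X x -> X y -> (forall v, ~ D v -> x v = y v) -> Delta X x y.
Proof.
move=> fD Xx Xy exy; split=> //; apply: sub_finite_set fD => v /= nxy.
by apply: contrapT => /exy.
Qed.

Lemma Delta_trans (X : set (config G A)) x y z :
  Delta X x y -> Delta X y z -> Delta X x z.
Proof.
case=> Xx _ fxy [_ Xz fyz].
apply: (@Delta_agree_off X (diff_sites x y `|` diff_sites y z)) => //.
  by rewrite finite_setU.
by move=> v /not_orP [/contrapT -> /contrapT].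
Qed.

Lemma language_restrict (X : set (config G A)) x F :
  X x -> language X (restrict x F).
Proof. by move=> Xx; exists F => //; exists x. Qed.

Lemma language_sub (X Y : set (config G A)) :
  X `<=` Y -> language X `<=` language Y.
Proof. by move=> XY p [F _ [x Xx <-]]; exact/language_restrict/XY. Qed.

End Configurations.

Section Cocycles.
Local Open Scope ring_scope.
Variables (R : realType) (G : graph) (A : finType) (X : set (config G A)).
Variable M : config G A -> config G A -> R.
Hypothesis cM : cocycle X M.

Lemma cocycle_refl x : X x -> M x x = 0.
Proof.
move=> Xx; have /eqP := cM (Delta_refl Xx) (Delta_refl Xx).
by rewrite -[X in X == _]addr0 (inj_eq (addrI _)) eq_sym => /eqP.
Qed.

Lemma cocycle_anti x y : Delta X x y -> M y x = - M x y.
Proof.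
move=> xy; apply/eqP; rewrite -addr_eq0 -(cM (Delta_sym xy) xy).
by rewrite cocycle_refl //; case: xy.
Qed.

End Cocycles.

(** * Gibbs sums and the Markov property *)

Section GibbsSums.
Local Open Scope ring_scope.
Variables (R : realType) (G : graph) (A : finType).
Implicit Types (x y z : config G A) (v u : G) (F E : {fset G}).

Definition gibbs_sum (V : pattern G A -> R) (x y : config G A) : R :=
  \sum_(F \in [set: {fset G}]) (V (restrict y F) - V (restrict x F)).

Lemma gibbs_sum_seq (V : pattern G A -> R) x y (s : seq {fset G}) :
  uniq s ->
  (forall F, V (restrict y F) != V (restrict x F) -> F \in s) ->
  gibbs_sum V x y = \sum_(F <- s) (V (restrict y F) - V (restrict x F)).
Proof.
move=> us sP; rewrite fsbig_seq // /gibbs_sum; apply/esym/fsbig_widen => //.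
move=> F [_ /= Fs]; apply/eqP; rewrite subr_eq0; apply: contraT => /sP.
by move/Fs.
Qed.

Lemma gibbs_support (X : set (config G A)) (V : pattern G A -> R) x y F :
  nn_interaction X V -> X x -> X y ->
  V (restrict y F) != V (restrict x F) ->
  clique F /\ exists2 v, v \in F & diff_sites x y v.
Proof.
move=> nV Xx Xy nVxy; split.
  apply: contrapT => ncF; case/eqP: nVxy.
  by rewrite !nV //; exact: language_restrict.
apply: contrapT => nF; case/eqP: nVxy; congr V; apply/restrictP => v vF.
by apply: contrapT => nxy; apply: nF; exists v => // /esym.
Qed.

(** A clique on which [x] and [y] disagree contains a site where they differ, so
    it lies in the closed neighbourhood of that site. *)
Lemma gibbs_sum_fpowerset (X : set (config G A)) (V : pattern G A -> R) x y E :
  nn_interaction X V -> X x -> X y ->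
  (forall v, (diff_sites x y `|` boundary (diff_sites x y)) v -> v \in E) ->
  gibbs_sum V x y =
  \sum_(F <- fpowerset E) (V (restrict y F) - V (restrict x F)).
Proof.
move=> nV Xx Xy DE; apply: gibbs_sum_seq => [|F]; first exact: fset_uniq.
move=> /(gibbs_support nV Xx Xy) [cF [v vF Dv]].
rewrite fpowersetE; apply/fsubsetP => u uF; apply: DE.
have [Du|nDu] := pselect (diff_sites x y u); [by left|right; split=> //].
exists v => //; apply: cF => //; apply/eqP => uv; apply: nDu; by rewrite uv.
Qed.

Definition fset_nbhd (D : set G) : {fset G} := fset_set (D `|` boundary D).

Lemma in_fset_nbhd (D : set G) : finite_set D ->
  forall v, v \in fset_nbhd D <-> (D `|` boundary D) v.
Proof.
move=> fD v; rewrite in_fset_set.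
  by split; rewrite inE.
by rewrite finite_setU; split=> //; exact: finite_boundary.
Qed.

Lemma nn_interaction_sub (X Y : set (config G A)) (V : pattern G A -> R) :
  X `<=` Y -> nn_interaction Y V -> nn_interaction X V.
Proof. by move=> /language_sub XY nV p /XY; exact: nV. Qed.

Lemma gibbs_sumD (X : set (config G A)) (V W : pattern G A -> R) x y :
  nn_interaction X V -> nn_interaction X W -> Delta X x y ->
  gibbs_sum (fun p => V p + W p) x y = gibbs_sum V x y + gibbs_sum W x y.
Proof.
move=> nV nW [Xx Xy fxy].
have nVW : nn_interaction X (fun p => V p + W p).
  by move=> p Xp cp; rewrite nV // nW // addr0.
have inE v := (in_fset_nbhd fxy v).2.
rewrite !(@gibbs_sum_fpowerset X _ x y (fset_nbhd (diff_sites x y))) //.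
by rewrite -big_split; apply: eq_bigr => F _; rewrite opprD addrACA.
Qed.

(** The three sums telescope once they are written over the subsets of one
    finite set [E]. *)
Lemma gibbs_sum_cocycle (X : set (config G A)) (V : pattern G A -> R) :
  nn_interaction X V -> cocycle X (gibbs_sum V).
Proof.
move=> nV x y z xy yz; have xz := Delta_trans xy yz.
case: xy yz xz => Xx Xy fxy [_ Xz fyz] [_ _ fxz].
pose N (a b : config G A) : {fset G} := fset_nbhd (diff_sites a b).
pose E : {fset G} := (N x y `|` (N y z `|` N x z))%fset.
have NE (a b : config G A) :
    finite_set (diff_sites a b) -> (N a b `<=` E)%fset -> forall v,
    (diff_sites a b `|` boundary (diff_sites a b)) v -> v \in E.
  by move=> fab /fsubsetP abE v /(in_fset_nbhd fab) /abE.
rewrite (gibbs_sum_fpowerset nV Xx Xz (NE _ _ fxz _)); last first.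
  by rewrite /E fsetUA fsubsetUr.
rewrite (gibbs_sum_fpowerset nV Xx Xy (NE _ _ fxy _)); last first.
  by rewrite /E fsubsetUl.
rewrite (gibbs_sum_fpowerset nV Xy Xz (NE _ _ fyz _)); last first.
  by rewrite /E fsetUCA fsubsetUl.
by rewrite -big_split; apply: eq_bigr => F _ /=; rewrite [RHS]addrC addrA subrK.
Qed.

Lemma gibbs_sum_markov (X : set (config G A)) (V : pattern G A -> R) :
  nn_interaction X V -> markov_cocycles X (gibbs_sum V).
Proof.
move=> nV; split; first exact: gibbs_sum_cocycle.
move=> x y x' y' [Xx Xy fxy] [Xx' Xy' _] D eD agree.
have nbD v := in_fset_nbhd fxy v.
rewrite (gibbs_sum_fpowerset nV Xx Xy (fun v => (nbD v).2)).
rewrite (@gibbs_sum_fpowerset X V x' y' (fset_nbhd D)) //; last first.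
  by move=> v; rewrite eD => /nbD.
rewrite !big_seq; apply: eq_bigr => F; rewrite fpowersetE => /fsubsetP FD.
by congr (V _ - V _); apply/restrictP => v /FD /nbD /agree [].
Qed.

Lemma markov_cocycles_eq (X : set (config G A))
    (M N : config G A -> config G A -> R) :
  (forall x y, Delta X x y -> M x y = N x y) ->
  markov_cocycles X N -> markov_cocycles X M.
Proof.
move=> MN [cN mN]; split.
  by move=> x y z xy yz; rewrite !MN //; [exact: cN|exact: Delta_trans yz].
by move=> x y x' y' xy xy' D eD agree; rewrite !MN //; exact: mN.
Qed.

Lemma markov_cocyclesB (X : set (config G A))
    (M N : config G A -> config G A -> R) :
  markov_cocycles X M -> markov_cocycles X N ->
  markov_cocycles X (fun x y => M x y - N x y).
Proof.
move=> [cM mM] [cN mN]; split.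
  by move=> x y z xy yz; rewrite (cM x y z) // (cN x y z) // opprD addrACA.
move=> x y x' y' xy xy' D eD agree.
by rewrite (mM x y x' y') // (mN x y x' y').
Qed.

Lemma gibbs_sub_markov (X : set (config G A)) :
  gibbs_cocycles X `<=`
  (markov_cocycles X : set (config G A -> config G A -> R)).
Proof.
move=> M [V nV MV]; apply: (markov_cocycles_eq (N := gibbs_sum V)) => //.
exact: gibbs_sum_markov.
Qed.

(** The Markov property with its hypotheses spelled out site by site: agreement
    off the difference, on it, and on its boundary. *)
Lemma markov_transport (X : set (config G A))
    (M : config G A -> config G A -> R) x y x' y' :
  markov_cocycles X M -> Delta X x y -> Delta X x' y' ->
  (forall v, x v = y v -> x' v = y' v) ->
  (forall v, x v <> y v -> x' v = x v /\ y' v = y v) ->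
  (forall u v, x v <> y v -> adj u v -> x' u = x u /\ y' u = y u) ->
  M x' y' = M x y.
Proof.
move=> [_ mM] xy xy' e0 e1 e2; apply: mM => //.
  apply/seteqP; split=> v /= => [nxy' /e0 //|nxy].
  by rewrite /diff_sites /=; have [-> ->] := e1 v nxy.
by move=> v [/e1 //|[_ [u ? ?]]]; exact: (e2 v u).
Qed.

End GibbsSums.

(** * The geometry of strong folding *)

Section Folding.
Variables (G : graph) (A : finType).
Implicit Types (x y z : config G A) (v u : G) (S E : pred G).

Definition fold_sites (a : A) (beta : config G A) (E : pred G) x : config G A :=
  fun v => if E v && (x v == a) then beta v else x v.

Definition splice (S : pred G) x z : config G A :=
  fun v => if S v then x v else z v.

(** The last field is the frame property: around a site [v] that can carry [a]
    there is a configuration [z] whose neighbours of [v] can be overwritten, one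
    by one and independently, by those of any [x] with [a] at [v]. *)
Record site_fold (X : set (config G A)) (a : A) (beta : config G A) : Prop :=
  SiteFold {
    beta_neq : forall v, beta v != a;
    fold_in : forall E x, X x -> X (fold_sites a beta E x);
    frame_ex : forall v x0, X x0 -> x0 v = a -> exists z,
      [/\ X z, z v = a &
        forall x S, X x -> x v = a -> (forall u, S u -> adj v u) ->
        X (splice S x z)] }.

Definition pair_allowed (X : set (config G A)) v u (c d : A) : Prop :=
  exists x, [/\ X x, x v = c & x u = d].

Lemma pair_allowed_sym X v u c d :
  pair_allowed X v u c d -> pair_allowed X u v d c.
Proof. by case=> x [Xx xv xu]; exists x. Qed.

Lemma language_pair X v u c d : v != u ->
  language_on [fset v; u]%fset X (pair_pattern v u c d) <->
  pair_allowed X v u c d.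
Proof.
move=> nvu; have pairE : pair_pattern v u c d =
    restrict (fun t => if t == v then c else d) [fset v; u]%fset by [].
split=> [[x Xx]|[x [Xx xv xu]]].
  rewrite pairE => /restrictP e; exists x; split=> //.
    by rewrite e ?eqxx // !inE eqxx.
  by rewrite e ?[u == v]eq_sym ?(negPf nvu) // !inE eqxx orbT.
exists x => //; rewrite pairE; apply/restrictP => t; rewrite !inE.
by have [->//|_ /eqP ->] := eqVneq t v.
Qed.

Lemma adj_neq v u : adj v u -> v != u.
Proof. by apply: contraTneq => ->; rewrite adj_irrefl. Qed.

Lemma bipartite_triangle_free v u u' :
  bipartite G -> adj v u -> adj v u' -> adj u u' -> False.
Proof.
case=> side bip vu vu' uu'; move: (bip _ _ vu) (bip _ _ vu') (bip _ _ uu').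
by case: (side v) (side u) (side u') => [] [] [].
Qed.

Lemma bipartite_clique (F : {fset G}) v : bipartite G -> clique F -> v \in F ->
  F = [fset v]%fset \/ exists2 u, adj v u & F = [fset v; u]%fset.
Proof.
move=> bipG cF vF.
have [[u [uF nuv]]|nF] := pselect (exists u, u \in F /\ u != v).
  have vu : adj v u by apply: cF; rewrite // eq_sym.
  right; exists u => //; apply/fsetP => t; rewrite !inE.
  have [->|ntv] := eqVneq t v; first by rewrite vF.
  have [->|ntu] := eqVneq t u; first by rewrite uF.
  apply/negP => tF; apply: (@bipartite_triangle_free v u t) => //.
    by apply: cF; rewrite // eq_sym.
  by apply: cF; rewrite // eq_sym.
left; apply/fsetP => t; rewrite !inE.
have [->//|ntv] := eqVneq t v; apply/negP => tF; apply: nF; by exists t.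
Qed.

(** Cliques of a bipartite graph have at most two vertices. Nonemptiness is
    what handles the empty clique, whose pattern may be forbidden. *)
Lemma nn_locally_in (X : set (config G A)) x :
  bipartite G -> nn_constraint_space X -> X !=set0 ->
  (forall v, exists2 y, X y & y v = x v) ->
  (forall v u, adj v u -> pair_allowed X v u (x v) (x u)) -> X x.
Proof.
move=> bipG [P cP XE] [x0 Xx0] x1 x2.
rewrite XE => p Pp px.
suff [y Xy py] : exists2 y, X y & restrict y (domf p) = restrict x (domf p).
  by move: Xy; rewrite XE => /(_ p Pp); apply; rewrite /appears py.
have [p0|[v vp]] := fset_0Vmem (domf p).
  by exists x0 => //; apply/restrictP => v; rewrite p0.
have [->|[u vu ->]] := bipartite_clique bipG (cP p Pp) vp.
  have [y Xy yv] := x1 v; exists y => //; apply/restrictP => t.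
  by rewrite !inE => /eqP ->.
have [y [Xy yv yu]] := x2 v u vu; exists y => //; apply/restrictP => t.
by rewrite !inE => /orP[] /eqP ->.
Qed.

Lemma gball1 v : gball 1 v = [set u | u = v \/ adj v u].
Proof.
apply/seteqP; split=> u.
  move=> [[|t [|? ?]]] [] //=; first by move=> _ ->; left.
  by rewrite andbT => vt <- _; right.
move=> [->|vu]; first by exists [::].
by exists [:: u]; rewrite /= vu.
Qed.

Lemma finite_boundary_gball1 v : finite_set (boundary (@gball G 1 v)).
Proof.
apply: finite_boundary; rewrite gball1.
rewrite (_ : [set u | _] = [set v] `|` [set w | adj v w]) //.
by rewrite finite_setU; split; [exact: finite_set1|exact: adj_locally_finite].
Qed.

(** The member [w] of the folded space supplies replacements for [a] at isolated
    vertices, which no edge condition constrains. The frame of [v] keeps a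
    configuration with [a] at [v] on the unit ball and is constantly [b] on the
    sphere of radius two. No two neighbours of [v] are adjacent, so only the
    edges leaving the ball need care, and their outer end carries [b], which is
    compatible with every symbol that is allowed next to [a]. *)
Lemma strongly_foldable_site_fold X a b (w : config G A) :
  bipartite G -> nn_constraint_space X -> a != b -> strongly_foldable X a b ->
  remove_symbol X a w ->
  exists beta : config G A, site_fold X a beta.
Proof.
move=> bipG nnX nab foldX [Xw nwa].
pose isolated v := forall u, ~ adj v u.
have sf v u c : adj v u -> pair_allowed X v u a c ->
    [/\ pair_allowed X v u b c,
        forall t, adj u t -> pair_allowed X u t c b &
        exists2 z, X z & forall t, boundary (gball 1 v) t -> z t = b].
  move=> vu /(language_pair _ _ _ (adj_neq vu)) ac.
  have uv : adj u v by rewrite adj_sym.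
  (* the fold condition admits the degenerate path that returns to v *)
  have [bc _ [z Xz zb]] := foldX v u v c vu uv ac.
  split.
  - exact/(language_pair _ _ _ (adj_neq vu)).
  - by move=> t ut; apply/(language_pair _ _ _ (adj_neq ut));
      have [] := foldX v u t c vu ut ac.
  - exists z => // t bt; move: zb.
    rewrite (_ : const_pattern _ _ = restrict (fun=> b) 
       (fset_set (boundary (gball 1 v)))) // => /restrictP -> //.
    by rewrite in_fset_set ?inE //; exact: finite_boundary_gball1.
pose beta v := if `[< isolated v >] then w v else b.
have betaE v u : adj v u -> beta v = b.
  by move=> vu; rewrite /beta; case: asboolP => // /(_ u) [].
exists beta; split.
- move=> v; rewrite /beta; case: asboolP => _; last by rewrite eq_sym.
  exact/eqP/nwa.
- move=> E x Xx.
  have pairs v u : adj v u ->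
      pair_allowed X v u (fold_sites a beta E x v) (fold_sites a beta E x u).
    move=> vu; have uv : adj u v by rewrite adj_sym.
    have xx : pair_allowed X v u (x v) (x u) by exists x.
    rewrite /fold_sites (betaE v u) // (betaE u v) //.
    case: ifP => [/andP[_ /eqP xv]|_].
      have bu : pair_allowed X v u b (x u).
        by rewrite xv in xx; have [] := sf v u (x u) vu xx.
      (* two adjacent symbols a: fold v first, then u next to the new b *)
      case: ifP => [/andP[_ /eqP xu]|//].
      apply: pair_allowed_sym; rewrite xu in bu.
      by have [] := sf u v b uv (pair_allowed_sym bu).
    case: ifP => [/andP[_ /eqP xu]|//].
    apply: pair_allowed_sym; rewrite xu in xx.
    by have [] := sf u v (x v) uv (pair_allowed_sym xx).
  apply: nn_locally_in => //; first by exists w.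
  move=> v; have [iv|] := pselect (isolated v).
    rewrite /fold_sites; case: ifP => _; last by exists x.
    by exists w => //; rewrite /beta asboolT.
  move=> /existsNP [u /contrapT vu].
  by have [y [Xy yv _]] := pairs v u vu; exists y.
- move=> v x0 Xx0 x0v.
  have [iv|] := pselect (isolated v).
    exists x0; split=> // x S Xx xv Sv; rewrite (_ : splice S x x0 = x0) //.
    by apply/funext => u; rewrite /splice; case: ifP => // /Sv /iv.
  move=> /existsNP [u0 /contrapT vu0].
  have [|_ _ [z1 Xz1 z1b]] := sf v u0 (x0 u0) vu0; first by exists x0.
  pose D : pred G := fun u => (u == v) || adj v u.
  have mixed y : y v = a -> (forall u, adj v u -> pair_allowed X v u a (y u)) ->
      (forall u, ~~ D u -> y u = z1 u) -> X y.
    move=> yv yN yD.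
    have edge p q : adj p q -> D p -> pair_allowed X p q (y p) (y q).
      move=> pq; case/orP => [/eqP pv|vp].
        by rewrite pv yv; apply: yN; rewrite -pv.
      have [->|nqv] := eqVneq q v.
        by rewrite yv; apply/pair_allowed_sym/yN.
      have nD : ~~ D q.
        rewrite /D (negPf nqv) /=; apply/negP => vq.
        exact: (bipartite_triangle_free bipG vp vq).
      have [_ H _] := sf v p (y p) vp (yN p vp).
      rewrite (yD q nD) z1b; first exact: H.
      rewrite gball1; split; last by exists p; [right|rewrite adj_sym].
      by move=> [qv|vq]; move: nD; rewrite /D ?qv ?eqxx // vq orbT.
    apply: nn_locally_in => //; first by exists w.
      move=> u; have [->|nuv] := eqVneq u v; first by exists x0; rewrite ?yv.
      have [/yN [x [Xx _ xu]]|nvu] := boolP (adj v u); first by exists x.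
      by exists z1 => //; rewrite yD // /D (negPf nuv).
    move=> p q pq; have [Dp|nDp] := boolP (D p); first exact: edge.
    have [Dq|nDq] := boolP (D q).
      by apply/pair_allowed_sym/edge => //; rewrite adj_sym.
    by exists z1; rewrite !yD.
  have mixed_in x S y : X x -> x v = a -> y v = a ->
     (forall u, adj v u -> y u = if S u then x u else x0 u) ->
     (forall u, ~~ D u -> y u = z1 u) -> X y.
    move=> Xx xv yv yN yD; apply: mixed => // u vu; rewrite yN //.
    by case: ifP => _; [exists x|exists x0].
  exists (splice D x0 z1); split.
  + apply: (mixed_in x0 predT) => //; rewrite /splice /D ?eqxx //.
      by move=> u ->; rewrite orbT.
    by move=> u /negPf ->.
  + by rewrite /splice /D eqxx.
  + move=> x S Xx xv Sv; have nSv : S v = false.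
      by apply/negP => /Sv; rewrite adj_irrefl.
    apply: (mixed_in x S) => //; rewrite /splice ?nSv /D ?eqxx //.
      by move=> u vu; rewrite vu orbT.
    move=> u; rewrite negb_or => /andP[/negPf nuv nvu].
    case: ifP => [/Sv|_]; first by rewrite (negPf nvu).
    by rewrite nuv (negPf nvu).
Qed.

End Folding.

(** * Interactions on vertices and edges *)

Section PairInteraction.
Local Open Scope ring_scope.
Variables (R : realType) (G : graph) (A : finType) (a : A).
Variables (phi : G -> A -> R) (psi : G -> G -> A -> A -> R).
Hypothesis psi_sym : forall v u c d, psi v u c d = psi u v d c.
Implicit Types (x y : config G A) (v u : G).

Definition nbrs (v : G) : {fset G} := fset_set [set u | adj v u].

Lemma in_nbrs v u : (u \in nbrs v) = adj v u.
Proof.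
rewrite in_fset_set; last exact: adj_locally_finite.
by apply/idP/idP; rewrite inE.
Qed.

(** An edge is listed by [enum_fset] in an unspecified order, which is why [psi]
    has to be symmetric. The default [a] is never reached. *)
Definition pair_interaction (p : pattern G A) : R :=
  let value v := odflt a p.[? v]%fmap in
  match enum_fset (domf p) with
  | [:: v] => phi v (value v)
  | [:: v; u] => if adj v u then psi v u (value v) (value u) else 0
  | _ => 0
  end.

Lemma pair_interaction1 x v :
  pair_interaction (restrict x [fset v]%fset) = phi v (x v).
Proof.
rewrite /pair_interaction /=.
have : perm_eq (enum_fset [fset v]%fset) [:: v].
  by apply: uniq_perm => [|//|t]; [exact: fset_uniq|rewrite !inE].
by move=> /perm_small_eq -> //; rewrite restrict_fnd !inE eqxx.
Qed.

Lemma pair_interaction2 x v u : adj v u ->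
  pair_interaction (restrict x [fset v; u]%fset) = psi v u (x v) (x u).
Proof.
move=> vu; have nvu := adj_neq vu; rewrite /pair_interaction /=.
have : perm_eq (enum_fset [fset v; u]%fset) [:: v; u].
  apply: uniq_perm; first exact: fset_uniq.
    by rewrite /= inE andbT.
  by move=> t; rewrite !inE.
have us := fset_uniq [fset v; u]%fset.
have vE : (restrict x [fset v; u]%fset).[? v]%fmap = Some (x v).
  by rewrite restrict_fnd !inE eqxx.
have uE : (restrict x [fset v; u]%fset).[? u]%fmap = Some (x u).
  by rewrite restrict_fnd !inE eqxx orbT.
case: (enum_fset _) us => [|p [|q [|? ?]]] us pq; have := perm_size pq => // _.
move: us; rewrite /= inE andbT => npq.
have : p \in [:: v; u] by rewrite -(perm_mem pq) inE eqxx.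
have : q \in [:: v; u] by rewrite -(perm_mem pq) !inE eqxx orbT.
rewrite !inE => /orP[]/eqP qE /orP[]/eqP pE; move: npq; rewrite pE qE ?eqxx //.
  by move=> _; rewrite adj_sym vu uE vE /= psi_sym.
by move=> _; rewrite vu uE vE.
Qed.

Lemma nn_pair_interaction (X : set (config G A)) :
  nn_interaction X pair_interaction.
Proof.
move=> p _ ncp; rewrite /pair_interaction.
have inE' t : (t \in domf p) = (t \in enum_fset (domf p)) by [].
case E : (enum_fset (domf p)) => [//|v [|u [|//]]].
  case: ncp => s t; rewrite !inE' E !inE => /eqP -> /eqP ->.
  by rewrite eqxx.
case: ifP => // vu; case: ncp => s t; rewrite !inE' E !inE.
move=> /orP[]/eqP -> /orP[]/eqP ->; rewrite ?eqxx //.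
by rewrite adj_sym.
Qed.

Lemma pair_interaction_step (X : set (config G A)) x y v :
  bipartite G -> X x -> X y -> (forall u, u != v -> y u = x u) ->
  gibbs_sum pair_interaction x y = phi v (y v) - phi v (x v) +
  \sum_(u <- nbrs v) (psi v u (y v) (x u) - psi v u (x v) (x u)).
Proof.
move=> bipG Xx Xy eyx; pose pair u : {fset G} := [fset v; u]%fset.
rewrite (@gibbs_sum_seq _ _ _ _ _ _ ([fset v]%fset :: map pair (nbrs v))).
- rewrite big_cons !pair_interaction1 big_map; congr (_ + _).
  rewrite !big_seq; apply: eq_bigr => u; rewrite in_nbrs => vu.
  by rewrite !pair_interaction2 // (eyx u) // eq_sym adj_neq.
- have pairv u : u \in nbrs v -> u != v.
    by rewrite in_nbrs eq_sym => /adj_neq.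
  rewrite /=; apply/andP; split.
    apply/mapP => -[u /pairv nuv] /fsetP /(_ u).
    by rewrite !inE eqxx orbT (negPf nuv).
  rewrite map_inj_in_uniq; first exact: fset_uniq.
  move=> u t /pairv nuv _ /fsetP /(_ u).
  by rewrite !inE eqxx orbT (negPf nuv) => /esym/eqP.
- move=> F /(gibbs_support (nn_pair_interaction (X := X)) Xx Xy) [cF [t tF nt]].
  have tv : t = v by apply: contrapT => /eqP /eyx /esym.
  rewrite tv in tF; have [->|[u vu ->]] := bipartite_clique bipG cF tF.
    by rewrite inE eqxx.
  by rewrite inE; apply/orP; right; apply: map_f; rewrite in_nbrs.
Qed.

End PairInteraction.

(** * Folds *)

Section FoldTheory.
Local Open Scope ring_scope.
Variables (R : realType) (G : graph) (A : finType) (X : set (config G A)).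
Variables (a : A) (beta : config G A).
Hypothesis sf : site_fold X a beta.
Implicit Types (x y z : config G A) (v u : G) (S E : pred G).

Local Notation W := (remove_symbol X a).
Local Notation fold := (fold_sites a beta).

Lemma remove_symbol_sub : W `<=` X.
Proof. by move=> x []. Qed.

Lemma Delta_remove_symbol x y : Delta W x y -> Delta X x y.
Proof. by move=> [[Xx _] [Xy _] fxy]. Qed.

Lemma fold_all_in x : X x -> W (fold predT x).
Proof.
move=> Xx; split; first exact: fold_in sf _ _ Xx.
move=> v; rewrite /fold_sites /=; case: eqP => // _.
exact/eqP/(beta_neq sf).
Qed.

Lemma fold_id E x : W x -> fold E x = x.
Proof.
move=> [_ nxa]; apply/funext => v; rewrite /fold_sites.
by case: eqP => [/nxa|_]; rewrite ?andbF.
Qed.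

Lemma Delta_fold E x y : Delta X x y -> Delta X (fold E x) (fold E y).
Proof.
move=> [Xx Xy fxy]; apply: (Delta_agree_off fxy).
- exact: fold_in sf _ _ Xx.
- exact: fold_in sf _ _ Xy.
- by move=> v /contrapT exy; rewrite /fold_sites exy.
Qed.

Lemma Delta_fold_all x y : Delta X x y -> Delta W (fold predT x) (fold predT y).
Proof.
move=> xy; have [_ _ fxy] := Delta_fold predT xy; case: xy => Xx Xy _.
by split=> //; exact: fold_all_in.
Qed.

(** Folding acts site by site, so it cannot enlarge the set of differing sites,
    and the values of the folded configurations on this set and its boundary
    are determined by the original ones. *)
Lemma fold_pullback_markov (M : config G A -> config G A -> R) :
  markov_cocycles W M ->
  markov_cocycles X (fun x y => M (fold predT x) (fold predT y)).
Proof.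
move=> mM; have [cM _] := mM; split.
  by move=> x y z xy yz; apply: cM; exact: Delta_fold_all.
move=> x y x' y' xy xy' F eF agree.
have sub v : fold predT x v <> fold predT y v -> F v.
  by move=> nxy exy; apply: nxy; rewrite /fold_sites exy.
apply: (markov_transport mM); [exact: Delta_fold_all|exact: Delta_fold_all|..].
- move=> v; have [Fv|nFv] := pselect (F v).
    by have [|] := agree v; [left|rewrite /fold_sites => -> ->].
  move=> _; have : ~ diff_sites x' y' v by rewrite eF.
  by move=> /contrapT e; rewrite /fold_sites e.
- move=> v /sub Fv; have [|] := agree v; first by left.
  by rewrite /fold_sites => -> ->.
- move=> u v /sub Fv uv; have [|] := agree u.
    have [Fu|nFu] := pselect (F u); [by left|right].
    by split=> //; exists v.
  by rewrite /fold_sites => -> ->.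
Qed.

(** An interaction for the pullback works for [M], as the total fold fixes
    [W]. *)
Lemma hammersley_clifford_remove_symbol :
  hammersley_clifford R X -> hammersley_clifford R W.
Proof.
move=> hcX; apply/seteqP; split; last exact: gibbs_sub_markov.
move=> M /fold_pullback_markov; rewrite hcX => -[V nV MV].
exists V; first exact: nn_interaction_sub remove_symbol_sub nV.
move=> x y xy; have [Wx Wy _] := xy.
rewrite -MV; last exact: Delta_remove_symbol.
by rewrite !fold_id.
Qed.

End FoldTheory.

(** * Unfolds: the energy of a one-site fold *)

Section Unfolding.
Local Open Scope ring_scope.
Variables (R : realType) (G : graph) (A : finType) (X : set (config G A)).
Variables (a : A) (beta : config G A).
Hypothesis (bipG : bipartite G) (sf : site_fold X a beta).
Implicit Types (x y z : config G A) (v u : G) (S E : pred G).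

Local Notation W := (remove_symbol X a).
Local Notation fold := (fold_sites a beta).

Variable M : config G A -> config G A -> R.
Hypothesis mM : markov_cocycles X M.

Let cM : cocycle X M. Proof. by case: mM. Qed.

Definition fold_cost x v : R := M x (fold (pred1 v) x).

Lemma Delta_fold_fset (F : {fset G}) x : X x -> Delta X x (fold (mem F) x).
Proof.
move=> Xx; apply: (@Delta_agree_off _ _ X [set` F]) => //.
- exact: fold_in sf _ _ Xx.
- by move=> v /negP /negPf /= vF; rewrite /fold_sites /= vF.
Qed.

Lemma fold1_fset v x : fold (pred1 v) x = fold (mem [fset v]%fset) x.
Proof. by apply/funext => u; rewrite /fold_sites /= inE. Qed.

Lemma Delta_fold1 v x : X x -> Delta X x (fold (pred1 v) x).
Proof. by rewrite fold1_fset; exact: Delta_fold_fset. Qed.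

Lemma fold_cost0 x v : X x -> x v != a -> fold_cost x v = 0.
Proof.
move=> Xx nxa; rewrite /fold_cost (_ : fold _ x = x) ?(cocycle_refl cM) //.
apply/funext => u; rewrite /fold_sites /=.
by case: (eqVneq u v) => [->|//]; rewrite (negPf nxa).
Qed.

Lemma fold_cost_local x y v : X x -> X y -> x v = y v ->
  (forall u, adj v u -> x u = y u) -> fold_cost x v = fold_cost y v.
Proof.
move=> Xx Xy exy nxy; apply: (markov_transport mM); try exact: Delta_fold1.
- move=> u; rewrite /fold_sites /=; have [->|//] := eqVneq u v.
  by rewrite exy.
- move=> u; rewrite /fold_sites /=; have [->|//] := eqVneq u v.
  by rewrite exy.
- move=> t u; rewrite /fold_sites /=; have [->|//] := eqVneq u v.
  move=> _ tv; have ntv := adj_neq tv.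
  by rewrite (negPf ntv) /= nxy // adj_sym.
Qed.

Definition is_frame v z : Prop :=
  [/\ X z, z v = a &
    forall x S, X x -> x v = a -> (forall u, S u -> adj v u) ->
    X (splice S x z)].

Definition set_site v (c : A) y : config G A :=
  fun t => if t == v then c else y t.

(** Changing [u] only sees the neighbours of [u]. Among them is [v], which
    carries [c] on both sides, but no site of [S], since [S] and [u] lie in the
    neighbourhood of [v] and the graph has no triangle. So the cost is the same
    in the frame [z] as after [S] has been overwritten. *)
Lemma increment_transport v u S x z c :
  adj v u -> (forall t, S t -> adj v t) -> S u = false ->
  let z' := splice (pred1 u) x z in
  let p := splice S x z in let q := splice (predU1 u S) x z in
  X (set_site v c z) -> X (set_site v c z') ->
  X (set_site v c p) -> X (set_site v c q) ->
  M (set_site v c p) (set_site v c q) = M (set_site v c z) (set_site v c z').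
Proof.
move=> vu Sv nSu z' p q Xz Xz' Xp Xq.
have Delta1 y y' :
    X y -> X y' -> (forall t, t != u -> y t = y' t) -> Delta X y y'.
  move=> Xy Xy' e; apply: (@Delta_agree_off _ _ X [set u]) => //.
  by move=> t /eqP /e.
apply: (markov_transport mM).
- by apply: Delta1 => // t /negPf ntu; rewrite /set_site /z' /splice /= ntu.
- by apply: Delta1 => // t /negPf ntu; rewrite /set_site /p /q /splice /= ntu.
- move=> t; rewrite /set_site /p /q /z' /splice /=.
  have [->|ntu] := eqVneq t u; last by [].
  by rewrite nSu.
- move=> t; rewrite /set_site /p /q /z' /splice /=.
  have [->|ntu] := eqVneq t u; last by case: ifP.
  by rewrite nSu.
- move=> s t; rewrite /set_site /p /q /z' /splice /=.
  have [->|ntu] := eqVneq t u; last by case: ifP.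
  move=> _ su; have nsu := adj_neq su; rewrite (negPf nsu) /=.
  suff -> : S s = false by [].
  apply/negP => /Sv vs; apply: (bipartite_triangle_free bipG vu vs).
  by rewrite adj_sym.
Qed.

(** In the square with sides: change [u], fold [v], the difference of the two
    fold costs is the difference of the two costs of changing [u], with
    [beta v] and with [a] at [v]. By [increment_transport] neither of the latter
    depends on [S]. *)
Lemma fold_cost_increment v u S x z : is_frame v z -> X x -> x v = a ->
  adj v u -> (forall t, S t -> adj v t) -> S u = false ->
  fold_cost (splice (predU1 u S) x z) v - fold_cost (splice S x z) v =
  fold_cost (splice (pred1 u) x z) v - fold_cost z v.
Proof.
move=> [Xz zv fz] Xx xv vu Sv nSu.
have S'v t : predU1 u S t -> adj v t by move=> /= /orP[/eqP ->|/Sv].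
have uv t : pred1 u t -> adj v t by move=> /= /eqP ->.
have Xp := fz _ _ Xx xv Sv; have Xq := fz _ _ Xx xv S'v.
have Xz' := fz _ _ Xx xv uv.
have notv (T : pred G) y : (forall t, T t -> adj v t) -> splice T y z v = a.
  by move=> Tv; rewrite /splice; case: ifP => // /Tv; rewrite adj_irrefl.
have set_id y : y v = a -> set_site v a y = y.
  by move=> yv; apply/funext => t; rewrite /set_site; case: eqP => // ->.
have set_fold y : y v = a -> fold (pred1 v) y = set_site v (beta v) y.
  move=> yv; apply/funext => t; rewrite /set_site /fold_sites /=.
  by case: eqP => // ->; rewrite yv eqxx.
have square y y' : X y -> X y' -> y v = a -> y' v = a ->
    (forall t, t != u -> y t = y' t) -> fold_cost y' v - fold_cost y v =
    M (set_site v (beta v) y) (set_site v (beta v) y') -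
    M (set_site v a y) (set_site v a y').
  move=> Xy Xy' yv y'v e; rewrite !set_id // -!set_fold //.
  have yy' : Delta X y y'.
    apply: (@Delta_agree_off _ _ X [set u]) => // t /eqP; exact: e.
  have e1 := cM (Delta_fold1 v Xy) (Delta_fold sf (pred1 v) yy').
  have e2 := cM yy' (Delta_fold1 v Xy').
  by rewrite /fold_cost; lra.
have Xset y : X y -> y v = a -> X (set_site v (beta v) y).
  by move=> Xy yv; rewrite -set_fold //; exact: fold_in sf _ _ Xy.
rewrite !square ?notv //; first last.
- by move=> t /negPf ntu; rewrite /splice /= ntu.
- by move=> t /negPf ntu; rewrite /splice /= ntu.
by congr (_ - _); apply: increment_transport; rewrite ?set_id ?notv //;
  apply: Xset; rewrite ?notv.
Qed.

Variable frame : G -> config G A.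
Hypothesis frameP : forall v x, X x -> x v = a -> is_frame v (frame v).

Definition nbr_cost v u (c : A) : R :=
  fold_cost (splice (pred1 u) (fun=> c) (frame v)) v - fold_cost (frame v) v.

(** Starting from the frame, overwrite the neighbours of [v] by those of [x] one
    after the other; each step adds its own increment. *)
Lemma fold_costE x v : X x -> x v = a ->
  fold_cost x v = fold_cost (frame v) v + \sum_(u <- nbrs v) nbr_cost v u (x u).
Proof.
move=> Xx xv; have fv := frameP Xx xv; have [Xz zv fz] := fv.
have partial (s : seq G) : uniq s -> {subset s <= nbrs v} ->
    fold_cost (splice (mem s) x (frame v)) v =
    fold_cost (frame v) v + \sum_(u <- s) nbr_cost v u (x u).
  elim: s => [_ _|u s IHs /= /andP[us uniqs] sub].
    by rewrite big_nil addr0; congr (fold_cost _ v); exact/funext.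
  have ss : {subset s <= nbrs v}.
    by move=> t ts; apply: sub; rewrite inE ts orbT.
  have sadj t : t \in s -> adj v t by move=> /ss; rewrite in_nbrs.
  rewrite big_cons addrCA -(IHs uniqs ss).
  have := @fold_cost_increment v u (mem s) x (frame v) fv Xx xv _ sadj
    (negPf us).
  move=> /(_ _)/eqP; rewrite subr_eq => H; apply/eqP.
  rewrite /nbr_cost (_ : splice (pred1 u) (fun=> x u) _ =
    splice (pred1 u) x (frame v)).
    by apply: H; rewrite -in_nbrs; apply: sub; rewrite inE eqxx.
  by apply/funext => t; rewrite /splice /=; case: eqP => // ->.
rewrite -partial ?fset_uniq //; apply: fold_cost_local => //.
- by apply: fz => // u /=; rewrite in_nbrs.
- by rewrite /splice /= in_nbrs adj_irrefl zv.
- by move=> u vu; rewrite /splice /= in_nbrs vu.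
Qed.

(** Both sides compare the two orders in which the adjacent sites [v] and [u]
    can be folded, and the cocycle equation makes the total costs equal. *)
Lemma nbr_cost_sym x v u : X x -> adj v u -> x v = a -> x u = a ->
  nbr_cost v u a - nbr_cost v u (beta u) =
  nbr_cost u v a - nbr_cost u v (beta v).
Proof.
have half v' u' : X x -> adj v' u' -> x v' = a -> x u' = a ->
   nbr_cost v' u' a - nbr_cost v' u' (beta u') =
   fold_cost x v' - fold_cost (fold (pred1 u') x) v'.
  move=> Xx vu xv xu; have nvu := adj_neq vu.
  have Xf : X (fold (pred1 u') x) := fold_in sf _ Xx.
  have fxv : fold (pred1 u') x v' = a by rewrite /fold_sites /= (negPf nvu).
  rewrite (fold_costE Xx xv) (fold_costE Xf fxv).
  rewrite !(big_rem u' (_ : u' \in enum_fset (nbrs v'))) /= ?in_nbrs // xu.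
  rewrite (_ : fold _ _ u' = beta u'); last first.
    by rewrite /fold_sites /= eqxx xu eqxx.
  rewrite (eq_big_seq (fun t => nbr_cost v' t (x t))
    (F1 := fun t => nbr_cost v' t (fold _ _ t))).
    by lra.
  move=> t; rewrite mem_rem_uniq ?fset_uniq // inE => /andP[/negPf ntu _].
  by rewrite /fold_sites /= ntu.
move=> Xx vu xv xu; have uv : adj u v by rewrite adj_sym.
rewrite (half v u) // (half u v) //.
have foldC :
    fold (pred1 v) (fold (pred1 u) x) = fold (pred1 u) (fold (pred1 v) x).
  apply/funext => t; rewrite /fold_sites /=.
  have [->|_] := eqVneq t v; last by [].
  by rewrite (negPf (adj_neq vu)).
have Xu : X (fold (pred1 u) x) := fold_in sf _ Xx.
have Xv : X (fold (pred1 v) x) := fold_in sf _ Xx.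
have := cM (Delta_fold1 u Xx) (Delta_fold1 v Xu).
have := cM (Delta_fold1 v Xx) (Delta_fold1 u Xv).
by rewrite /fold_cost foldC; lra.
Qed.

Definition fold_phi v (c : A) : R :=
  if c == a then - fold_cost (frame v) v else 0.

(** The share of [u] in the cost of folding [v], averaged over the cases where
    [u] is folded before or after [v]. The average matters only when both carry
    [a]; it makes the edge energy symmetric without choosing an order. *)
Definition half_cost v u (c d : A) : R :=
  if c == a then
    (nbr_cost v u d + nbr_cost v u (if d == a then beta u else d)) / 2
  else 0.

Definition fold_psi v u (c d : A) : R :=
  - (half_cost v u c d + half_cost u v d c).

Definition fold_interaction := pair_interaction a fold_phi fold_psi.

Lemma fold_psi_sym v u c d : fold_psi v u c d = fold_psi u v d c.
Proof. by rewrite /fold_psi addrC. Qed.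

(** Folding [v] removes its own energy and the [half_cost] of its edges. At an
    edge with [a] at both ends it also replaces the average for the other end by
    its value next to [beta v], a discrepancy that [nbr_cost_sym] absorbs. *)
Lemma gibbs_sum_fold1 x v : X x ->
  gibbs_sum fold_interaction x (fold (pred1 v) x) = fold_cost x v.
Proof.
move=> Xx; have Xf : X (fold (pred1 v) x) := fold_in sf _ Xx.
have [xv|nxv] := eqVneq (x v) a; last first.
  rewrite fold_cost0 // (_ : fold _ x = x); last first.
    apply/funext => u; rewrite /fold_sites /=.
    by case: (eqVneq u v) => [->|//]; rewrite (negPf nxv).
  by rewrite /gibbs_sum fsbig1 // => F _; rewrite subrr.
rewrite (@pair_interaction_step _ _ _ _ _ _ fold_psi_sym X _ _ v) //; last first.
  by move=> u /negPf nuv; rewrite /fold_sites /= nuv.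
rewrite (fold_costE Xx xv) (_ : fold _ x v = beta v); last first.
  by rewrite /fold_sites /= eqxx xv eqxx.
have nb := negPf (beta_neq sf v).
rewrite /fold_phi nb xv eqxx opprK add0r; congr (_ + _).
rewrite !big_seq; apply: eq_bigr => u; rewrite in_nbrs => vu.
rewrite /fold_psi /half_cost nb eqxx; case: eqP => [xu|_]; last by lra.
by have := nbr_cost_sym Xx vu xv xu; rewrite xu; lra.
Qed.

Lemma gibbs_sum_fold_W x y : W x -> W y -> gibbs_sum fold_interaction x y = 0.
Proof.
move=> Wx Wy; have V0 z F : W z -> fold_interaction (restrict z F) = 0.
  move=> Wz; have nz v : z v == a = false by apply/eqP; case: Wz.
  have [cF|ncF] := pselect (clique F); last first.
    apply: (@nn_pair_interaction _ _ _ _ _ _ X) ncF.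
    by apply: language_restrict; case: Wz.
  have [->|[v vF]] := fset_0Vmem F.
    rewrite /fold_interaction /pair_interaction.
    suff -> : enum_fset (domf (restrict z fset0)) = [::] by [].
    exact: size0nil (cardfs0 G).
  have [->|[u vu ->]] := bipartite_clique bipG cF vF.
    by rewrite /fold_interaction pair_interaction1 /fold_phi nz.
  rewrite /fold_interaction pair_interaction2 //; last exact: fold_psi_sym.
  by rewrite /fold_psi /half_cost !nz addr0 oppr0.
by rewrite /gibbs_sum fsbig1 // => F _; rewrite !V0 // subrr.
Qed.

End Unfolding.

(** * Unfolds: reduction to one-site folds *)

Section Unfold.
Local Open Scope ring_scope.
Variables (R : realType) (G : graph) (A : finType) (X : set (config G A)).
Variables (a : A) (beta : config G A).
Hypothesis (bipG : bipartite G) (sf : site_fold X a beta).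
Implicit Types (x y z : config G A) (v u : G) (S E : pred G).

Local Notation W := (remove_symbol X a).
Local Notation fold := (fold_sites a beta).

(** Fold both configurations on the closed neighbourhood [E] of their
    difference. This takes finitely many one-site folds, and afterwards they
    look, on the difference and its boundary, like totally folded ones, though
    they may still carry [a] elsewhere. *)
Lemma markov_fold_zero (N : config G A -> config G A -> R) :
  markov_cocycles X N ->
  (forall x v, X x -> N x (fold (pred1 v) x) = 0) ->
  (forall x y, Delta W x y -> N x y = 0) ->
  forall x y, Delta X x y -> N x y = 0.
Proof.
move=> mN N1 NW x y xy; have [cN _] := mN.
have Nfold (F : {fset G}) z : X z -> N z (fold (mem F) z) = 0.
  move=> Xz; elim/finSet_rect: F => F IH.
  have [->|[v vF]] := fset_0Vmem F.
    by rewrite (_ : fold _ z = z) ?(cocycle_refl cN).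
  have Xf : X (fold (mem (F `\ v)%fset) z) := fold_in sf _ Xz.
  rewrite (_ : fold (mem F) z = fold (pred1 v) (fold (mem (F `\ v)%fset) z)).
    rewrite (cN _ (fold (mem (F `\ v)%fset) z)); last exact: Delta_fold1.
      by rewrite N1 // addr0 IH // fproperD1.
    exact: Delta_fold_fset.
  apply/funext => t; rewrite /fold_sites /= !inE.
  have [->|ntv] := eqVneq t v; first by rewrite vF.
  by [].
have [Xx Xy fxy] := xy.
pose E := fset_nbhd (diff_sites x y).
have nbE v := in_fset_nbhd fxy v.
have fE z v : v \in E -> fold (mem E) z v = fold predT z v.
  by move=> vE; rewrite /fold_sites /= vE.
have fxy0 : N (fold (mem E) x) (fold (mem E) y) = 0.
  rewrite -(NW _ _ (Delta_fold_all sf xy)).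
  have diffE v : fold predT x v <> fold predT y v -> diff_sites x y v.
    by move=> nxy exy; apply: nxy; rewrite /fold_sites exy.
  apply: (markov_transport mN); [| exact: Delta_fold | ..].
  - exact/Delta_remove_symbol/(Delta_fold_all sf xy).
  - move=> v e; have [vE|vE] := boolP (v \in E); first by rewrite !fE.
    suff exy : x v = y v by rewrite /fold_sites exy.
    by apply: contrapT => nxy; move/negP: vE; apply; apply/nbE; left.
  - by move=> v /diffE Dv; rewrite !fE //; apply/nbE; left.
  - move=> u v /diffE Dv uv.
    suff uE : u \in E by rewrite !fE.
    apply/nbE; have [Du|nDu] := pselect (diff_sites x y u); [by left|right].
    by split=> //; exists v.
have xE := Delta_fold_fset sf E Xx; have yE := Delta_fold_fset sf E Xy.
rewrite (cN _ _ _ xE (Delta_trans (Delta_sym xE) xy)).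
rewrite (cN _ _ _ (Delta_fold sf (mem E) xy) (Delta_sym yE)).
by rewrite (cocycle_anti cN yE) !Nfold // fxy0 oppr0 !addr0.
Qed.

Lemma markov_vanishing_gibbs (M : config G A -> config G A -> R) :
  markov_cocycles X M -> (forall x y, Delta W x y -> M x y = 0) ->
  gibbs_cocycles X M.
Proof.
move=> mM MW.
have /choice [frame frameP] : forall v, exists z,
    forall x, X x -> x v = a -> is_frame X a v z.
  move=> v; have [[x0 [Xx0 x0v]]|nx] := pselect (exists x, X x /\ x v = a).
    have [z fz] := frame_ex sf Xx0 x0v; exists z => x _ _; exact: fz.
  (* a default value, at a vertex where a never occurs *)
  by exists beta => x Xx xv; case: nx; exists x.
pose V := fold_interaction a beta M frame.
have nV : nn_interaction X V by exact: nn_pair_interaction.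
exists V => // x y xy; apply/eqP; rewrite -subr_eq0; apply/eqP.
move: x y xy; apply: (@markov_fold_zero (fun x y => M x y - gibbs_sum V x y)).
- exact/markov_cocyclesB/gibbs_sum_markov.
- by move=> x v Xx; rewrite (gibbs_sum_fold1 bipG sf mM frameP) // subrr.
- move=> x y xy; have [Wx Wy _] := xy.
  by rewrite MW // (gibbs_sum_fold_W (X := X)) // subrr.
Qed.

(** Extending an interaction of [W] by zero to the other patterns of [X] gives a
    Gibbs cocycle that agrees with [M] on [W]. *)
Lemma hammersley_clifford_unfold :
  hammersley_clifford R W -> hammersley_clifford R X.
Proof.
move=> hcW; apply/seteqP; split; last exact: gibbs_sub_markov.
move=> M mM; have : gibbs_cocycles W M.
  rewrite -hcW; case: mM => cM mM; split.
    move=> x y z xy yz.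
    exact: cM (Delta_remove_symbol xy) (Delta_remove_symbol yz).
  move=> x y x' y' xy xy'.
  exact: mM (Delta_remove_symbol xy) (Delta_remove_symbol xy').
move=> [V nV MV].
pose V' p := if `[< language W p >] then V p else 0.
have nV' : nn_interaction X V'.
  by move=> p _ ncp; rewrite /V'; case: asboolP => // Wp; exact: nV.
have VV' x F : W x -> V' (restrict x F) = V (restrict x F).
  by move=> Wx; rewrite /V' asboolT //; exact: language_restrict.
have [] := @markov_vanishing_gibbs (fun x y => M x y - gibbs_sum V' x y).
- exact/markov_cocyclesB/gibbs_sum_markov.
- move=> x y xy; have [Wx Wy _] := xy; rewrite (MV _ _ xy).
  apply/eqP; rewrite subr_eq0; apply/eqP; apply: eq_fsbigr => F _.
  by rewrite !VV'.
move=> U nU MU; exists (fun p => U p + V' p).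
  by move=> p Xp cp; rewrite nU // nV' // addr0.
move=> x y xy; rewrite -[RHS]/(gibbs_sum (fun p => U p + V' p) x y).
rewrite (gibbs_sumD nU nV' xy).
rewrite [gibbs_sum U x y](_ : _ = M x y - gibbs_sum V' x y).
  by rewrite subrK.
exact/esym/MU.
Qed.

End Unfold.

Lemma hammersley_clifford0 (R : realType) (G : graph) (A : finType) :
  hammersley_clifford R (set0 : set (config G A)).
Proof.
apply/seteqP; split=> M _.
  by exists (fun=> 0%R) => [p _ _ //|x y []].
by split=> [x y z []|x y x' y' []].
Qed.

Theorem theorem4p1 (R : realType) (G : graph) (A : finType)
    (X : set (config G A))
    (bipG : bipartite G)
    (nnX : nn_constraint_space X)
    (hcX : hammersley_clifford R X) :
  (forall Y : set (config G A),
     strong_config_fold X Y -> hammersley_clifford R Y) /\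
  (forall Y : set (config G A),
     strong_config_unfold X Y -> X !=set0 -> hammersley_clifford R Y).
Proof.
split=> Y.
  move=> [_ [a [b [nab foldX ->]]]].
  have [->|/set0P [w Ww]] := eqVneq (remove_symbol X a) set0.
    exact: hammersley_clifford0.
  have [beta sf] := strongly_foldable_site_fold bipG nnX nab foldX Ww.
  exact: (hammersley_clifford_remove_symbol sf).
move=> [nnY [a [b [nab foldY XE]]]] [w Xw]; rewrite XE in hcX Xw.
have [beta sf] := strongly_foldable_site_fold bipG nnY nab foldY Xw.
exact: (hammersley_clifford_unfold bipG sf).
Qed.
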